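(* Fix a monetary budget $M_A>0$, a per-unit cost $c_A>0$ of pre-allocated resources, $R_B>0$, and $\boldsymbol{w}\in\mathbb{R}^n_{>0}$ with $\sum_b w_b=1$. Consider $$\pi_A^{\mathrm{opt}}:=\max_{(P,R_A)\in\mathcal{I}(M_A)}\pi_A^*(P,R_A,R_B),\qquad \mathcal{I}(M_A):=\{(P,R_A)\in\mathbb{R}^2_{\ge0}: R_A+c_AP\le M_A\}.$$ Let $t:=\min\{1,M_A/R_B\}$. Then player $A$'s optimal investment in pre-allocated resources is $$P^*=\begin{cases}\frac{2(1-c_A)}{2-c_A}\frac{M_A}{c_A} & \text{if } c_A<t,\\ \text{any value in } \Big[0,\frac{2(1-c_A)}{2-c_A}\frac{M_A}{c_A}\Big] & \text{if } c_A=t,\\ 0 & \text{if } c_A>t,\end{cases}$$ with optimal real-time investment $R_A^*=M_A-c_AP^*$, and $$\pi_A^{\mathrm{opt}}=\begin{cases}1-\frac{R_B}{2M_A}c_A(2-c_A) & \text{if } c_A<t,\\ 1-\frac{R_B}{2M_A} & \text{if } c_A\ge t \text{ and } M_A/R_B\ge 1,\\ \frac{M_A}{2R_B} & \text{if } c_A\ge t \text{ and } M_A/R_B<1.\end{cases}$$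
   Context: General Lotto game with pre-allocations $\mathrm{GL\text{-}P}(P,R_A,R_B,\boldsymbol{w})$: two players $A,B$ compete over battlefields $\{1,\dots,n\}$ with values $w_b>0$, $\sum_b w_b=1$. Player $A$ has $P\ge 0$ pre-allocated resources and $R_A\ge 0$ real-time resources; player $B$ has $R_B>0$ real-time resources. Stage 1: $A$ chooses $\boldsymbol{p}\in\Delta_n(P):=\{\boldsymbol{p}\in\mathbb{R}^n_{\ge 0}:\|\boldsymbol{p}\|_1=P\}$, binding and known to $B$. Stage 2: simultaneously, each player $i$ chooses a probability distribution $F_i$ on $\mathbb{R}^n_{\ge0}$ with $\mathbb{E}[\sum_b x_{i,b}]\le R_i$. $A$'s payoff is $\mathbb{E}[\sum_b w_b\,\mathbf{1}\{x_{A,b}+p_b\ge x_{B,b}\}]$ (ties arbitrary, not affecting results), $B$'s is one minus this. For every $\boldsymbol{p}$ the Stage 2 game has a Nash equilibrium with unique payoffs. In a subgame-perfect equilibrium (SPE), Stage 2 strategies form a Nash equilibrium for each $\boldsymbol{p}$ and $\boldsymbol{p}^*$ maximizes $A$'s resulting Stage 2 equilibrium payoff. $\pi_A^*(P,R_A,R_B)$ denotes $A$'s (unique) SPE payoff. The per-unit cost of real-time resources is normalized to 1. *)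

(* Defs.v *)
From HB Require Import structures.
From mathcomp Require Import all_boot all_order all_algebra.
From mathcomp Require Import all_classical all_reals all_analysis.
Set Implicit Arguments. Unset Strict Implicit. Unset Printing Implicit Defensive.
Import Order.TTheory GRing.Theory Num.Theory.
Local Open Scope classical_set_scope.
Local Open Scope ring_scope.

Section lotto.
Variable R : realType.
Variable n : nat.

(* A mixed strategy of a player with real-time budget [Rb] is represented by
   a random vector [X = (X b)_{b < n}] with values in R^n_{>=0}, defined on some
   probability space [(Om, P)]; its law is the distribution F_i on R^n_{>=0}.
   Budget constraint: E[ sum_b X b ] <= Rb. *)
Definition is_strategy (Rb : R) d (Om : measurableType d)
    (P : probability Om R) (X : 'I_n -> Om -> R) : Prop :=
  (forall b, measurable_fun setT (X b)) /\
  (forall b om, 0 <= X b om) /\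
  (\int[P]_om (\sum_(b < n) X b om)%:E <= Rb%:E)%E.

Definition payoffA (w p : 'I_n -> R)
    dA (OmA : measurableType dA) (PA : probability OmA R) (XA : 'I_n -> OmA -> R)
    dB (OmB : measurableType dB) (PB : probability OmB R) (XB : 'I_n -> OmB -> R)
    : R :=
  \sum_(b < n) w b *
     fine ((PA \x PB)%E [set z | XB b z.2 <= XA b z.1 + p b]).

Definition stage2_NE_payoff (w p : 'I_n -> R) (RA RB v : R) : Prop :=
  exists dA (OmA : measurableType dA) (PA : probability OmA R) (XA : 'I_n -> OmA -> R),
  exists dB (OmB : measurableType dB) (PB : probability OmB R) (XB : 'I_n -> OmB -> R),
    [/\ is_strategy RA PA XA, is_strategy RB PB XB,
        payoffA w p PA XA PB XB = v,
        (forall dA' (OmA' : measurableType dA') (PA' : probability OmA' R)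
                (XA' : 'I_n -> OmA' -> R),
            is_strategy RA PA' XA' -> payoffA w p PA' XA' PB XB <= v) &
        (forall dB' (OmB' : measurableType dB') (PB' : probability OmB' R)
                (XB' : 'I_n -> OmB' -> R),
            is_strategy RB PB' XB' -> v <= payoffA w p PA XA PB' XB')].

Definition in_simplex (P : R) (p : 'I_n -> R) : Prop :=
  (forall b, 0 <= p b) /\ \sum_(b < n) p b = P.

Definition SPE_payoff (w : 'I_n -> R) (P RA RB pi : R) : Prop :=
  [/\ (forall p, in_simplex P p -> exists v, stage2_NE_payoff w p RA RB v),
      (exists2 p, in_simplex P p & stage2_NE_payoff w p RA RB pi) &
      (forall p v, in_simplex P p -> stage2_NE_payoff w p RA RB v -> v <= pi)].

Definition feasible_invest (MA cA P RA : R) : Prop :=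
  [/\ 0 <= P, 0 <= RA & RA + cA * P <= MA].

Definition opt_value (w : 'I_n -> R) (MA cA RB pi : R) : Prop :=
  (exists P RA, feasible_invest MA cA P RA /\ SPE_payoff w P RA RB pi) /\
  (forall P RA pi', feasible_invest MA cA P RA -> SPE_payoff w P RA RB pi' ->
     pi' <= pi).

Definition opt_invest (w : 'I_n -> R) (MA cA RB P RA : R) : Prop :=
  feasible_invest MA cA P RA /\
  exists pi, SPE_payoff w P RA RB pi /\ opt_value w MA cA RB pi.

End lotto.

(* Main.v *)
(** Normalize the pre-allocation on battlefield [b] to [q b = p b / w b].  For
   multipliers [1 / al] of A and [1 / be] of B, the second stage splits into
   all-pay auctions with head start [q b], solved explicitly: both players
   randomize uniformly over an interval of length proportional to
   [mu b = clip al (be - q b)].  The two budget equations determine [(al, be)];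
   a solution exists by the intermediate value theorem, and it gives a saddle
   point.  B's multiplier at this saddle point certifies, through inequalities
   that are linear in [q], hence depend only on [P = sum_b p b], an upper bound
   on every equilibrium payoff ([dual_bound]).  Optimizing this bound under
   [RA + cA P <= MA] gives the value and forces the optimal [(P, RA)];
   pre-allocating proportionally to [w] attains it. *)

Require Import Defs.
From HB Require Import structures.
From mathcomp Require Import all_boot all_order all_algebra.
From mathcomp Require Import all_classical all_reals all_analysis.
From mathcomp Require Import measurable_realfun ring lra.
Import Order.TTheory GRing.Theory Num.Theory.
Import numFieldNormedType.Exports.
Local Open Scope classical_set_scope.
Local Open Scope ring_scope.
Set Implicit Arguments.
Unset Strict Implicit.
Unset Printing Implicit Defensive.

(** * Clipping *)

(** For [a >= 0] this is the projection of [x] onto the interval from [0] to [a]. *)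
Definition clip (R : realFieldType) (a x : R) : R := Num.max 0 (Num.min a x).

Lemma clipP (R : realFieldType) (a x : R) : 0 <= a ->
  [\/ x <= 0 /\ clip a x = 0,
      0 <= x <= a /\ clip a x = x |
      a < x /\ clip a x = a].
Proof.
move=> a0; have [x0|x0] := leP x 0.
  by apply: Or31; split=> //; apply/max_idPl; rewrite ge_min x0 orbT.
have [xa|xa] := leP x a.
  by apply: Or32; rewrite ltW//; split=> //; rewrite /clip (min_idPr xa) (max_idPr (ltW x0)).
by apply: Or33; split=> //; rewrite /clip (min_idPl (ltW xa)) (max_idPr a0).
Qed.

(** With [mu] the clipped value and [x = be - q], the bracket is [m ^+ 2 - 2 * m * x] if [mu = 0],
    the square [(m - x) ^+ 2] if [mu = x], and [(al - m) ^+ 2 - 2 * m * (x - al)] if [mu = al]; the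
    last case uses [m * la <= 1]. Apart from [mu ^+ 2], which the budget of A controls, the bound is
    affine in [q]. *)
Lemma clip_quadratic (R : realFieldType) (al be q la m : R) :
  0 < al -> 0 < be -> 0 <= q -> 0 <= la -> 0 <= m -> m * la <= 1 ->
  Num.min 1 ((q + clip al (be - q)) / be) <=
  1 + la / (2 * be) * (clip al (be - q) ^+ 2 + m ^+ 2 - 2 * m * (be - q)).
Proof.
move=> al0 be0 q0 la0 m0 ml.
have bi : 0 < be^-1 by rewrite invr_gt0.
have bb : be * be^-1 = 1 by rewrite mulfV ?gt_eqF.
have -> : la / (2 * be) = la * be^-1 / 2 by rewrite invfM; lra.
have lb : 0 <= la * be^-1 by rewrite mulr_ge0// ltW.
rewrite ge_min; apply/orP.
have [[h ->]|[/andP[h1 h2] ->]|[h ->]] := clipP (be - q) (ltW al0).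
- left; rewrite lerDl mulr_ge0//; first by rewrite divr_ge0.
  by have := sqr_ge0 m; nra.
- left; rewrite lerDl mulr_ge0//; first by rewrite divr_ge0.
  by have := sqr_ge0 (m - (be - q)); nra.
right.
have : 0 <= la * be^-1 * (al - m) ^+ 2 by rewrite mulr_ge0 ?sqr_ge0.
have : 0 <= (1 - m * la) * (be^-1 * (be - q - al)).
  by rewrite mulr_ge0 ?subr_ge0// mulr_ge0 ?(ltW bi)//; lra.
have e : (q + al) / be = 1 - be^-1 * (be - q - al) by rewrite -bb; ring.
rewrite e; nra.
Qed.

(** Per battlefield, this equates the constants guaranteed by A and by B once the expected bids are
    priced at [1 / al] and [1 / be]. It is what closes the gap between the two guarantees. *)
Lemma clip_value (R : realFieldType) (al be q : R) : 0 < al -> 0 < be -> 0 <= q ->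
  Num.min 1 ((q + clip al (be - q)) / be) =
  1 - clip al (be - q) / al + clip al (be - q) ^+ 2 / (2 * be) / al
   + clip al (be - q) * (2 * q + clip al (be - q)) / (2 * al) / be.
Proof.
move=> al0 be0 q0.
have bb : be / be = 1 by rewrite mulfV ?gt_eqF.
have [[h ->]|[/andP[h1 h2] ->]|[h ->]] := clipP (be - q) (ltW al0).
- rewrite (min_idPl _); last by rewrite ler_pdivlMr//; lra.
  by rewrite expr0n/= !mul0r; lra.
- rewrite (min_idPl _); last by rewrite ler_pdivlMr//; lra.
  by field; rewrite !gt_eqF.
- rewrite (min_idPr _); last by rewrite ler_pdivrMr//; lra.
  by field; rewrite !gt_eqF.
Qed.

(** A monic quadratic is negative between distinct roots; the midpoint is the test point. *)
Lemma midpoint_roots (R : realFieldType) (x0 x1 : R) : 0 < x0 -> 0 < x1 ->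
  (forall x, 0 < x -> 0 <= (x - x0) * (x - x1)) -> x0 = x1.
Proof.
move=> p0 p1 h.
have := h ((x0 + x1) / 2); have -> : 0 < (x0 + x1) / 2 by lra.
move=> /(_ isT) h'; have : (x0 - x1) ^+ 2 <= 0 by nra.
by move=> h2; apply/eqP; rewrite -subr_eq0 -sqrf_eq0 eq_le h2 sqr_ge0.
Qed.

(** * Optimization of the dual bound *)

(* Lagrangian bound: [b] is B's multiplier and [la] an arbitrary multiplier of A.
   A's Lagrangian payoff is concave in the pre-allocation; [m] ranges over its
   tangents, so that only the total [P] matters. *)
Definition dual_bound (R : realFieldType) (RA RB P b v : R) : Prop :=
  forall la m, 0 <= la -> 0 <= m -> m * la <= 1 ->
    v <= 1 - RB * b + la * (RA - m + (m ^+ 2 / 2 + m * P) * b).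

(** Here [c] is the price of pre-allocations after capping and [M] the largest amount of them that
    the whole budget [c * M] buys. In these variables the three cases of the value become two. *)
Definition opt_formula (R : realFieldType) (c M RB : R) : R :=
  if RB <= M then 1 - RB * (1 - c / 2) / M else c * M / (2 * RB).

Section dual.
Context {R : realFieldType} {c M RA RB P b v : R}.
Hypotheses (c_gt0 : 0 < c) (M_gt0 : 0 < M) (RB_gt0 : 0 < RB).
Hypotheses (RA_ge0 : 0 <= RA) (P_ge0 : 0 <= P) (budget : RA + c * P <= c * M).
Hypotheses (b_gt0 : 0 < b) (dual : dual_bound RA RB P b v).

Lemma dual_bound0 : v <= 1 - RB * b.
Proof. by have := dual (lexx 0) (lexx 0); rewrite !mul0r addr0; apply. Qed.

(* The case [la = b / y], [m = y / b]. *)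
Lemma dual_bound_scaled (y : R) : 0 < y ->
  v * y <= b * RA - RB * b * y + y ^+ 2 / 2 + P * b * y.
Proof.
move=> y0; have bN : b != 0 by rewrite gt_eqF.
have yN : y != 0 by rewrite gt_eqF.
have := @dual (b / y) (y / b) (ltW (divr_gt0 b_gt0 y0)) (ltW (divr_gt0 y0 b_gt0)).
have -> : y / b * (b / y) = 1 by field; rewrite bN yN.
move=> /(_ (lexx 1)); rewrite -(ler_pM2r y0) => /le_trans; apply.
by rewrite le_eqVlt; apply/orP; left; apply/eqP; field; rewrite yN bN.
Qed.

(** The substitution [m = y / b] with [la] left free, needed where the one-parameter family of
    [dual_bound_scaled] is too weak. *)
Lemma dual_bound_mul (la y : R) : 0 <= la -> 0 <= y -> y * la <= b ->
  v <= 1 - RB * b + la * (RA + P * y) + la / b * (y ^+ 2 / 2 - y).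
Proof.
move=> la0 y0 h; have bN : b != 0 by rewrite gt_eqF.
have := @dual la (y / b) la0 (divr_ge0 y0 (ltW b_gt0)).
have -> : y / b * la <= 1 by rewrite mulrAC ler_pdivrMr// mul1r.
move=> /(_ isT) /le_trans; apply.
by rewrite le_eqVlt; apply/orP; left; apply/eqP; field.
Qed.

(** At [y = c] the investments enter only through [RA + c * P], which the budget bounds. *)
Lemma dual_bound1 : v <= c / 2 + (M - RB) * b.
Proof.
have := dual_bound_scaled c_gt0 => h.
rewrite -(ler_pM2r c_gt0); apply: le_trans h _.
have : 0 <= b * (c * M - (RA + c * P)) by rewrite mulr_ge0 ?subr_ge0// ltW.
nra.
Qed.

Lemma dual_le : v <= opt_formula c M RB.
Proof.
rewrite /opt_formula; have := dual_bound0; have := dual_bound1 => h1 h0.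
have [RM|RM] := leP RB M.
  rewrite -subr_ge0 -(pmulr_rge0 _ M_gt0).
  have -> : M * (1 - RB * (1 - c / 2) / M - v) = M * (1 - v) - RB * (1 - c / 2).
    by field; rewrite gt_eqF.
  (* The bound of [dual_bound0] decreases in [b] and that of [dual_bound1] does not; they cross at
     [M * b = 1 - c / 2], where both equal the claimed value. *)
  have [h|h] := leP (1 - c / 2) (M * b).
    have : 0 <= RB * (M * b - (1 - c / 2)) by rewrite mulr_ge0 ?subr_ge0// ltW.
    have : 0 <= M * (1 - RB * b - v) by rewrite mulr_ge0 ?subr_ge0// ltW.
    nra.
  have : 0 <= (M - RB) * (1 - c / 2 - M * b) by rewrite mulr_ge0 ?subr_ge0// ltW.
  have : 0 <= M * (c / 2 + (M - RB) * b - v) by rewrite mulr_ge0 ?subr_ge0// ltW.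
  nra.
have RB2 : 0 < 2 * RB by rewrite mulr_gt0.
rewrite ler_pdivlMr//.
(* Now [dual_bound1] also decreases in [b] and reaches the claimed value at [b = c / (2 * RB)]. For
   smaller [b] the choice [y = 2 * RB * b] cancels [- RB * b * y] against [y ^+ 2 / 2]. *)
have [h|h] := leP c (2 * RB * b).
  have : 0 <= (RB - M) * (2 * RB * b - c) by rewrite mulr_ge0 ?subr_ge0// ltW.
  have : 0 <= RB * (c / 2 + (M - RB) * b - v) by rewrite mulr_ge0 ?subr_ge0// ltW.
  nra.
have h2 := dual_bound_scaled (mulr_gt0 RB2 b_gt0).
rewrite -(ler_pM2r b_gt0) -mulrA; apply: le_trans h2 _.
have : 0 <= b * (c * M - (RA + c * P)) by rewrite mulr_ge0 ?subr_ge0// ltW.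
have : 0 <= P * b * (c - 2 * RB * b) by rewrite !mulr_ge0 ?subr_ge0// ltW.
nra.
Qed.

Hypothesis v_opt : v = opt_formula c M RB.

(** Equality puts [b] at the crossing point of the two bounds. Then [v = 1 - RB * b], so the factor
    of [la] in the dual bound is nonnegative for every [m >= 0]; two choices of [m] determine the
    investment. *)
Lemma dual_eq_lt : RB < M ->
  RA + c * P = c * M /\ (1 - c / 2) * P = (1 - c) * M.
Proof.
move=> RM; have := dual_bound0; have := dual_bound1; have := v_opt.
rewrite /opt_formula (ltW RM) => vE h1 h0.
have MN : M != 0 by rewrite gt_eqF.
have vM : v * M = M - RB * (1 - c / 2) by rewrite vE; field.
have Mb : M * b = 1 - c / 2.
  apply/eqP; rewrite eq_le; apply/andP; split.
    rewrite -(ler_pM2l RB_gt0).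
    by have := h0; rewrite -(ler_pM2r M_gt0); nra.
  have RM' : 0 < M - RB by rewrite subr_gt0.
  rewrite -(ler_pM2l RM').
  by have := h1; rewrite -(ler_pM2r M_gt0); nra.
have vb : v = 1 - RB * b.
  by apply: (mulIf MN); rewrite vM mulrBl mul1r -mulrA [b * M]mulrC Mb.
have gE m : 0 <= m -> 0 <= RA - m + (m ^+ 2 / 2 + m * P) * b.
  move=> m0; have m1 : 0 < m + 1 by lra.
  have := @dual (m + 1)^-1 m; rewrite invr_ge0 ltW// => /(_ isT m0).
  have -> : m / (m + 1) <= 1 by rewrite ler_pdivrMr//; lra.
  by move=> /(_ isT); rewrite vb lerDl pmulr_rge0// invr_gt0.
have bN : b != 0 by rewrite gt_eqF.
have RAE : RA + c * P = c * M.
  apply/eqP; rewrite eq_le budget/=.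
  have := gE (c / b) (divr_ge0 (ltW c_gt0) (ltW b_gt0)).
  have -> : RA - c / b + ((c / b) ^+ 2 / 2 + c / b * P) * b =
            RA + c * P - c * ((1 - c / 2) / b) by field.
  by rewrite -Mb mulfK// subr_ge0.
split=> //.
(* The next test point [b^-1 - P] minimizes the quadratic in [m]; this bound makes it nonnegative.
   The discriminant condition then reads [(1 - c - P * b) ^+ 2 <= 0]. *)
have x1 : P * b <= 1 - c / 2.
  rewrite -Mb ler_pM2r// -(ler_pM2l c_gt0); move: RA_ge0 budget; lra.
have := gE (b^-1 - P) _.
have -> : 0 <= b^-1 - P.
  by rewrite subr_ge0 -(ler_pM2r b_gt0) mulVf//; move: c_gt0; lra.
move=> /(_ isT) h.
have {}h : 0 <= 2 * b * RA - (1 - P * b) ^+ 2.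
  have := mulr_ge0 (ltW (mulr_gt0 (ltr0Sn R 1) b_gt0)) h; congr (_ <= _).
  by field.
have RAb : b * RA = c * (1 - c / 2) - c * (P * b).
  by rewrite -Mb -(addrK (c * P) RA) RAE; ring.
have {}h : (1 - c - P * b) ^+ 2 <= 0 by nra.
have xE : P * b = 1 - c.
  by apply/esym/eqP; rewrite -subr_eq0 -sqrf_eq0 eq_le h sqr_ge0.
by rewrite -Mb -mulrA [b * P]mulrC xE mulrC.
Qed.

(** The last hypothesis says that [dual_bound1] is tight. The scaled bound then becomes
    [0 <= (y - c) * (y - 2 * (M * b - P * b))] for all [y > 0], so the roots coincide. *)
Lemma dual_roots : 0 < RA -> RA + c * P = c * M -> c / 2 - RB * b = v - M * b ->
  c = 2 * (M * b - P * b).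
Proof.
move=> RA0 RAE vE.
have z0 : 0 < M * b - P * b.
  by rewrite -mulrBl mulr_gt0// subr_gt0 -(ltr_pM2l c_gt0); lra.
apply: midpoint_roots => //; first by rewrite mulr_gt0.
move=> y y0; have := dual_bound_scaled y0.
have -> : b * RA = c * (M * b - P * b) by rewrite -(addrK (c * P) RA) RAE; ring.
have -> : v = c / 2 - RB * b + M * b by rewrite vE; ring.
nra.
Qed.

Lemma dual_eq_gt : 0 < RA -> M < RB -> RA = c * M /\ P = 0.
Proof.
move=> RA0 RM; have := dual_bound1; have := v_opt.
rewrite /opt_formula leNgt RM/= => vE h1.
have RB2 : 0 < 2 * RB by rewrite mulr_gt0.
have vR : v * (2 * RB) = c * M by rewrite vE divfK ?gt_eqF.
have bc : 2 * RB * b <= c.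
  have RM' : 0 < RB - M by rewrite subr_gt0.
  rewrite -(ler_pM2l RM').
  by have := h1; rewrite -(ler_pM2r RB2); nra.
(* The same [y = 2 * RB * b] as in [dual_le]; tightness now exhausts the budget and forces
   [(c - 2 * RB * b) * P = 0]. *)
have := dual_bound_scaled (mulr_gt0 RB2 b_gt0) => h.
have {}h : c * M <= RA + 2 * RB * b * P.
  by rewrite -(ler_pM2r b_gt0) -vR; nra.
have cP : 0 <= (c - 2 * RB * b) * P by rewrite mulr_ge0// subr_ge0.
have RAE : RA + c * P = c * M by apply/eqP; rewrite eq_le budget/=; lra.
suff P0 : P = 0 by split=> //; rewrite -RAE P0 mulr0 addr0.
(* If [P > 0], then [2 * RB * b = c = 2 * (M - P) * b], against [M < RB]. *)
move: P_ge0; rewrite le_eqVlt => /predU1P[//|P0].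
have cE : 2 * RB * b = c.
  apply/eqP; rewrite eq_le bc/= -(ler_pM2r P0); lra.
have := dual_roots RA0 RAE.
have -> : c / 2 - RB * b = v - M * b.
  have RN : RB != 0 by rewrite gt_eqF.
  by rewrite vE -cE; field.
move=> /(_ erefl) e; exfalso.
have : 0 < b * (RB - M) by rewrite mulr_gt0 ?subr_gt0.
have : 0 < P * b by rewrite mulr_gt0.
by move: e; rewrite -{1}cE; lra.
Qed.

Lemma dual_eq_eq : 0 < RA -> RB = M ->
  RA + c * P = c * M /\ (1 - c / 2) * P <= (1 - c) * M.
Proof.
move=> RA0 RM; have := v_opt; rewrite /opt_formula RM lexx => vE.
have {}vE : v = c / 2 by rewrite vE; field; rewrite gt_eqF.
have RAE : RA + c * P = c * M.
  apply/eqP; rewrite eq_le budget/=.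
  have := dual_bound_scaled c_gt0; rewrite vE RM => h; rewrite -(ler_pM2l b_gt0); lra.
split=> //.
have cE : c = 2 * (M * b - P * b).
  by apply: dual_roots => //; rewrite vE RM.
have RAb : b * RA = c * (M * b - P * b) by rewrite -(addrK (c * P) RA) RAE; ring.
(* This is [dual_bound_mul] with [la = b / c], after eliminating [RA]. Letting [y] tend to [c] would
   give [P * b <= 1 - c]. *)
have key y : 0 <= y -> y <= c -> 0 <= (c - y) * (1 - P * b - (c + y) / 2).
  move=> y0 yc; have cN : c != 0 by rewrite gt_eqF.
  have bN : b != 0 by rewrite gt_eqF.
  have := @dual_bound_mul (b / c) y (divr_ge0 (ltW b_gt0) (ltW c_gt0)) y0.
  have -> : y * (b / c) <= b.
    by rewrite mulrA ler_pdivrMr// mulrC ler_pM2l.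
  move=> /(_ isT); rewrite -(ler_pM2r c_gt0) vE RM.
  have -> : (1 - M * b + b / c * (RA + P * y) + b / c / b * (y ^+ 2 / 2 - y)) * c =
     c - c * (M * b) + b * RA + P * b * y + y ^+ 2 / 2 - y by field; rewrite cN bN.
  by rewrite RAb; lra.
have x0 : 0 <= 1 - P * b - c / 2.
  by have := key 0 (lexx 0) (ltW c_gt0); rewrite subr0 addr0 pmulr_rge0.
have xc : P * b <= 1 - c.
  rewrite leNgt; apply/negP => h.
  (* In place of a limit: if [1 - P * b < c], this [y] makes the product in [key] equal to minus
     half a nonzero square. *)
  have := key (1 - P * b); have -> : 0 <= 1 - P * b by move: c_gt0; lra.
  have -> : 1 - P * b <= c by lra.
  move=> /(_ isT isT).
  have -> : 1 - P * b - (c + (1 - P * b)) / 2 = - ((c - (1 - P * b)) / 2) by field.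
  have : 0 < (c - (1 - P * b)) ^+ 2 by rewrite exprn_gt0//; lra.
  nra.
rewrite -(ler_pM2r b_gt0).
have : 0 <= c * (1 - c - P * b) by rewrite mulr_ge0 ?subr_ge0// ltW.
nra.
Qed.

End dual.

(** * Existence of the multipliers *)

Lemma continuous_clip (R : realType) (f g : R -> R) :
  continuous f -> continuous g -> continuous (fun x => clip (f x) (g x)).
Proof.
move=> cf cg.
have cmax (h k : R -> R) : continuous h -> continuous k ->
    continuous (fun x => Num.max (h x) (k x)).
  move=> ch ck x; under eq_fun do rewrite maxr_absE.
  apply: cvgM; last exact: cvg_cst.
  apply: cvgD; first by apply: cvgD; [exact: ch|exact: ck].
  by apply: cvg_norm; apply: cvgB; [exact: ch|exact: ck].
have cmin (h k : R -> R) : continuous h -> continuous k ->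
    continuous (fun x => Num.min (h x) (k x)).
  move=> ch ck x; under eq_fun do rewrite minr_absE.
  apply: cvgM; last exact: cvg_cst.
  apply: cvgB; first by apply: cvgD; [exact: ch|exact: ck].
  by apply: cvg_norm; apply: cvgB; [exact: ch|exact: ck].
by apply: cmax; [move=> x; exact: cvg_cst|exact: cmin].
Qed.

Lemma continuous_bigsum (R : realType) (n : nat) (F : 'I_n -> R -> R) :
  (forall i, continuous (F i)) -> continuous (fun x => \sum_(i < n) F i x).
Proof.
move=> cF; rewrite (_ : (fun x => _) = \sum_(i < n) F i); last first.
  by apply/funext => x; rewrite fct_sumE.
apply: (big_ind (fun f : R -> R => continuous f)) => //.
- by move=> x; exact: cvg_cst.
- by move=> f g cf cg x; apply: cvgD; [exact: cf|exact: cg].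
Qed.

Lemma clip_ge0 (R : realFieldType) (a x : R) : 0 <= clip a x.
Proof. by rewrite /clip le_max lexx. Qed.

Lemma clip_le1 (R : realFieldType) (a x : R) : x <= 1 -> clip a x <= 1.
Proof. by move=> x1; rewrite /clip ge_max ler01/= ge_min x1 orbT. Qed.

Lemma clip_mono (R : realFieldType) (a x y : R) : x <= y -> clip a x <= clip a y.
Proof.
move=> xy; rewrite /clip ge_max !le_max lexx/=; apply/orP.
have [|h] := leP (Num.min a x) 0; [by left|right].
by rewrite le_min !ge_min lexx xy orbT.
Qed.

Lemma clip_lip (R : realFieldType) (a b x : R) : `|clip a x - clip b x| <= `|a - b|.
Proof.
wlog ab : a b / a <= b.
  move=> h; have [ab|/ltW ab] := leP a b; first exact: h.
  by rewrite distrC [leRHS]distrC; exact: h.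
rewrite distrC [leRHS]distrC [leRHS]ger0_norm ?subr_ge0// ger0_norm.
- rewrite lerBlDr /clip ge_max; apply/andP; split.
    by rewrite addr_ge0 ?subr_ge0// le_max lexx.
  rewrite -lerBlDl le_max; apply/orP; right.
  by rewrite le_min; have [|] := leP b x; lra.
- rewrite subr_ge0 /clip ge_max !le_max lexx/=; apply/orP.
  have [|h] := leP (Num.min a x) 0; [by left|right].
  by rewrite le_min !ge_min lexx ab orbT.
Qed.

Lemma lipschitz_continuous (R : realType) (k : R) (f : R -> R) : 0 < k ->
  (forall x y, `|f x - f y| <= k * `|x - y|) -> continuous f.
Proof.
move=> k0 lip x; apply/cvgrPdist_lt => e e0; near=> y.
apply: le_lt_trans (lip _ _) _; rewrite mulrC -ltr_pdivlMr//.
near: y; apply: cvgr_dist_lt; [exact: cvg_id|exact: divr_gt0].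
Unshelve. all: by end_near.
Qed.

Lemma exists_multipliers (R : realType) (n : nat) (w q : 'I_n -> R) (RA RB : R) :
  (forall b, 0 < w b) -> \sum_(b < n) w b = 1 -> (forall b, 0 <= q b) ->
  0 < RA -> 0 < RB ->
  exists al be : R, [/\ 0 < al, 0 < be,
    \sum_(b < n) w b * (clip al (be - q b) ^+ 2 / (2 * be)) = RA &
    \sum_(b < n) w b * (clip al (be - q b) * (2 * q b + clip al (be - q b)) / (2 * al))
      = RB].
Proof.
move=> w0 w1 q0 RA0 RB0.
(* In the unknowns [s = 1 / be] and [r = al / be], [nu = mu / be]; the first
   budget equation defines [s] as a Lipschitz function of [r]. *)
pose nu r s b := clip r (1 - q b * s).
pose T r s := \sum_(b < n) w b * nu r s b ^+ 2.
have nu0 r s b : 0 <= nu r s b by exact: clip_ge0.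
have nu1 r s b : 0 <= s -> nu r s b <= 1.
  by move=> s0; apply: clip_le1; rewrite gerBl mulr_ge0.
have nu2 r s b : 0 <= s -> 0 <= nu r s b ^+ 2 <= 1.
  by move=> s0; rewrite sqr_ge0 expr_le1// nu1.
have T0 r s : 0 <= T r s.
  by apply: sumr_ge0 => b _; rewrite mulr_ge0 ?sqr_ge0 ?ltW.
have T1 r s : 0 <= s -> T r s <= 1.
  move=> s0; rewrite -w1; apply: ler_sum => b _.
  by rewrite ler_piMr ?(ltW (w0 b))//; have /andP[] := nu2 r s b s0.
have Tmono r s s' : s <= s' -> T r s' <= T r s.
  move=> ss; apply: ler_sum => b _; rewrite ler_pM2l// lerXn2r ?nnegrE//.
  by apply: clip_mono; rewrite lerD2l lerN2 ler_wpM2l.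
have Tlip r r' s : 0 <= s -> `|T r s - T r' s| <= 2 * `|r - r'|.
  move=> s0; rewrite /T -sumrB.
  apply: le_trans (ler_norm_sum _ _ _) _.
  rewrite -[leRHS]mul1r -w1 mulr_suml; apply: ler_sum => b _.
  rewrite -mulrBr normrM (gtr0_norm (w0 b)) ler_pM2l//.
  rewrite subr_sqr normrM mulrC; apply: ler_pM => //; last exact: clip_lip.
  rewrite ger0_norm ?addr_ge0//.
  by have := nu1 r s b s0; have := nu1 r' s b s0; lra.
have cnu b (f g : R -> R) : continuous f -> continuous g ->
    continuous (fun r => nu (f r) (g r) b).
  move=> cf cg; apply: continuous_clip; first exact: cf.
  move=> x; apply: cvgB; first exact: cvg_cst.
  by apply: cvgM; [exact: cvg_cst|exact: cg].
have exs r : exists s, 0 <= s /\ 2 * RA * s = T r s.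
  (* Since [T] lies between 0 and 1, [f] changes sign between [0] and [(2 * RA)^-1]. *)
  pose f s := 2 * RA * s - T r s.
  have k0 : 0 <= (2 * RA)^-1 by rewrite invr_ge0 mulr_ge0// ltW.
  have cf : continuous f.
    move=> x; apply: cvgB; first by apply: cvgM; [exact: cvg_cst|exact: cvg_id].
    apply: continuous_bigsum => b y; apply: cvgM; first exact: cvg_cst.
    have cn : continuous (fun s => nu r s b).
      by apply: (cnu b (fun=> r) id) => z; [exact: cvg_cst|exact: cvg_id].
    by apply: cvgM; exact: cn.
  have f0 : f 0 <= 0 by rewrite /f mulr0 sub0r oppr_le0.
  have f1 : 0 <= f (2 * RA)^-1.
    by rewrite /f divff ?gt_eqF ?mulr_gt0// subr_ge0 T1.
  have := @IVT R f 0 (2 * RA)^-1 0 k0 (continuous_subspaceT cf).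
  rewrite ge_min f0/= le_max f1 orbT => /(_ isT)[c].
  rewrite in_itv/= => /andP[c0 _] /eqP; rewrite subr_eq0 => /eqP fc.
  by exists c.
have [s sP] := choice exs.
have s0 r : 0 <= s r by case: (sP r).
have sE r : 2 * RA * s r = T r (s r) by case: (sP r).
(* Because [T] is nonincreasing in its second argument, both values of [T] can be compared at the
   same point [s r']. So the chosen [s] is automatically continuous. *)
have slip r r' : `|s r - s r'| <= RA^-1 * `|r - r'|.
  wlog ss : r r' / s r' <= s r.
    move=> h; have [ss|/ltW ss] := leP (s r') (s r); first exact: h.
    by rewrite distrC (distrC r); exact: h.
  rewrite ler_pdivlMl// ger0_norm ?subr_ge0//.
  have := Tlip r r' (s r') (s0 r'); have := Tmono r _ _ ss.
  have := ler_norm (T r (s r') - T r' (s r')).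
  rewrite -(sE r) -(sE r'); lra.
have cs : continuous s by apply: lipschitz_continuous slip; rewrite invr_gt0.
have spos r : 0 < r -> 0 < s r.
  move=> r0; rewrite lt_neqAle s0 andbT; apply/eqP => s00.
  have := sE r; rewrite -s00 mulr0 => /esym; apply/eqP; rewrite gt_eqF//.
  rewrite /T; under eq_bigr => b _ do rewrite /nu mulr0 subr0.
  by rewrite -mulr_suml w1 mul1r exprn_gt0// /clip lt_max lt_min r0 ltr01 orbT.
(* With [al = r / sg] and [be = sg^-1], the second budget equation reads
   [H r sg = 2 * RB * r * sg]. *)
pose H r sg := \sum_(b < n) w b * (nu r sg b * (2 * q b * sg + nu r sg b)).
suff [r [sg [r0 sg0 Tr Hr]]] : exists r sg, [/\ 0 < r, 0 < sg,
    T r sg = 2 * RA * sg & H r sg = 2 * RB * r * sg].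
  have rN : r != 0 by rewrite gt_eqF.
  have sN : sg != 0 by rewrite gt_eqF.
  have clipE b : clip (r / sg) (sg^-1 - q b) = nu r sg b / sg.
    have si : 0 <= sg^-1 by rewrite invr_ge0 ltW.
    rewrite /nu /clip maxr_pMl// minr_pMl// mul0r; congr (Num.max _ (Num.min _ _)).
    by rewrite mulrBl mul1r mulfK.
  exists (r / sg), sg^-1; rewrite divr_gt0 ?invr_gt0//; split=> //.
    apply: (@mulfI _ (2 * sg)); first by rewrite mulf_neq0 ?pnatr_eq0.
    have -> : 2 * sg * RA = T r sg by rewrite Tr; ring.
    rewrite mulr_sumr; apply: eq_bigr => b _; rewrite clipE.
    by field; rewrite sN.
  apply: (@mulfI _ (2 * r * sg)); first by rewrite !mulf_neq0 ?pnatr_eq0.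
  have -> : 2 * r * sg * RB = 2 * RB * r * sg by ring.
  rewrite -Hr mulr_sumr; apply: eq_bigr => b _; rewrite clipE.
  by field; rewrite sN rN.
(* Chosen so that [2 * RB * r0 * s r0 <= 2 * RA * s r0 = T r0 (s r0) <= H r0 (s r0)], hence
   [h r0 >= 0]. *)
pose r0 := Num.min 1 (RA / RB).
have r00 : 0 < r0 by rewrite /r0 lt_min ltr01 divr_gt0.
have r01 : r0 <= 1 by rewrite /r0 ge_min lexx.
pose h r := H r (s r) - 2 * RB * r * s r.
have h0 : 0 <= h r0.
  have : 0 <= 2 * s r0 * (RA - RB * r0).
    by rewrite !mulr_ge0// subr_ge0 mulrC -ler_pdivlMr// /r0 ge_min lexx orbT.
  have : T r0 (s r0) <= H r0 (s r0).
    apply: ler_sum => b _; rewrite ler_pM2l// expr2 ler_wpM2l// lerDr.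
    by rewrite !mulr_ge0.
  by rewrite -sE /h; nra.
(* Either [h] has a zero between [r0] and [1], or the solution has [r >= 1], where the equation is
   linear in [r]. *)
have [h1|h1] := leP (h 1) 0.
  have ch : continuous h.
    move=> x; apply: cvgB; last first.
      by apply: cvgM; [apply: cvgM; [exact: cvg_cst|exact: cvg_id]|exact: cs].
    apply: continuous_bigsum => b y; apply: cvgM; first exact: cvg_cst.
    have cn : continuous (fun r => nu r (s r) b) by apply: (cnu b id) => // z; exact: cvg_id.
    apply: cvgM; first exact: cn.
    by apply: cvgD; [apply: cvgM; [exact: cvg_cst|exact: cs]|exact: cn].
  have := @IVT R h r0 1 0 r01 (continuous_subspaceT ch).
  rewrite ge_min h1 orbT/= le_max h0 => /(_ isT)[r].
  rewrite in_itv/= => /andP[rr _] /eqP; rewrite subr_eq0 => /eqP hr.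
  have rp : 0 < r by exact: lt_le_trans rr.
  by exists r, (s r); rewrite sE spos.
have s1 := spos 1 ltr01.
have RBs : 0 < 2 * RB * s 1 by rewrite !mulr_gt0.
pose r := H 1 (s 1) / (2 * RB * s 1).
(* For [r >= 1], [nu] and hence [s] no longer depend on [r]. *)
have r1 : 1 <= r by rewrite ler_pdivlMr// mul1r; move: h1; rewrite /h mulr1; lra.
have nuE b : nu r (s 1) b = nu 1 (s 1) b.
  have x1 : 1 - q b * s 1 <= 1 by rewrite gerBl mulr_ge0.
  by rewrite /nu /clip (min_idPr (le_trans x1 r1)) (min_idPr x1).
exists r, (s 1); split=> //.
- exact: lt_le_trans ltr01 r1.
- by rewrite sE; apply: eq_bigr => b _; rewrite nuE.
- transitivity (H 1 (s 1)); first by apply: eq_bigr => b _; rewrite nuE.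
  by rewrite /r; field; rewrite !gt_eqF.
Qed.

(** * Product probabilities and the uniform distribution *)

(** By Fubini, a conditional winning probability bounded by an affine function of the opponent's bid
    integrates to the same affine function of the expected bid. *)
Lemma product_prob_le1 (R : realType) (d1 d2 : measure_display)
  (T1 : measurableType d1) (T2 : measurableType d2)
  (P1 : probability T1 R) (P2 : probability T2 R)
  (S : set (T1 * T2)) (c k : R) (Y : T1 -> R) :
  measurable S -> 0 <= c -> 0 <= k ->
  measurable_fun setT Y -> (forall x, 0 <= Y x) ->
  (forall x, (P2 (xsection S x) <= (c + k * Y x)%:E)%E) ->
  ((P1 \x P2)%E S <= c%:E + k%:E * \int[P1]_x (Y x)%:E)%E.
Proof.
move=> mS c0 k0 mY Y0 h.
have /measurable_EFinP mY' := mY.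
have -> : (c%:E + k%:E * \int[P1]_x (Y x)%:E =
           \int[P1]_x (c%:E + k%:E * (Y x)%:E))%E.
  rewrite ge0_integralD//=; last 2 first.
  - by move=> x _; rewrite mule_ge0 ?lee_fin.
  - exact: emeasurable_funM.
  rewrite ge0_integralZl//=; last by move=> x _; rewrite lee_fin.
  by congr (_ + _)%E; rewrite integral_cst//= probability_setT mule1.
apply: ge0_le_integral => //=.
- exact: measurable_fun_xsection.
- by apply: emeasurable_funD => //; exact: emeasurable_funM.
Qed.

Lemma product_prob_le2 (R : realType) (d1 d2 : measure_display)
  (T1 : measurableType d1) (T2 : measurableType d2)
  (P1 : probability T1 R) (P2 : probability T2 R)
  (S : set (T1 * T2)) (c k : R) (Y : T2 -> R) :
  measurable S -> 0 <= c -> 0 <= k ->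
  measurable_fun setT Y -> (forall x, 0 <= Y x) ->
  (forall x, (P1 (ysection S x) <= (c + k * Y x)%:E)%E) ->
  ((P1 \x P2)%E S <= c%:E + k%:E * \int[P2]_x (Y x)%:E)%E.
Proof.
move=> mS c0 k0 mY Y0 h.
have /measurable_EFinP mY' := mY.
(* The product measure is defined through sections over the first factor; uniqueness allows sections
   over the second. *)
have -> : (P1 \x P2)%E S = (P1 \x^ P2)%E S.
  apply: (@product_measure_unique _ _ _ _ _ P1 P2 (P1 \x^ P2)%E) => // A B mA mB.
  exact: product_measure2E.
have -> : (c%:E + k%:E * \int[P2]_x (Y x)%:E =
           \int[P2]_x (c%:E + k%:E * (Y x)%:E))%E.
  rewrite ge0_integralD//=; last 2 first.
  - by move=> x _; rewrite mule_ge0 ?lee_fin.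
  - exact: emeasurable_funM.
  rewrite ge0_integralZl//=; last by move=> x _; rewrite lee_fin.
  by congr (_ + _)%E; rewrite integral_cst//= probability_setT mule1.
apply: ge0_le_integral => //=.
- exact: measurable_fun_ysection.
- by apply: emeasurable_funD => //; exact: emeasurable_funM.
Qed.

Lemma product_prob_fin_num (R : realType) (d1 d2 : measure_display)
  (T1 : measurableType d1) (T2 : measurableType d2)
  (P1 : probability T1 R) (P2 : probability T2 R) (S : set (T1 * T2)) :
  measurable S -> (P1 \x P2)%E S \is a fin_num.
Proof.
move=> mS; rewrite ge0_fin_numE//.
by apply: le_lt_trans (probability_le1 (P1 \x P2)%E mS) _; exact: ltry.
Qed.

Lemma product_prob_setC (R : realType) (d1 d2 : measure_display)
  (T1 : measurableType d1) (T2 : measurableType d2)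
  (P1 : probability T1 R) (P2 : probability T2 R) (S : set (T1 * T2)) :
  measurable S -> ((P1 \x P2) (~` S) = 1 - (P1 \x P2) S)%E.
Proof. exact: (probability_setC (P1 \x P2)%E). Qed.

(** Bids are nonnegative with a finite total mean, so each mean is a real number and the budget
    becomes a finite sum of reals. *)
Lemma strategy_mean (R : realType) (n : nat) (Rb : R) (d : measure_display)
  (Om : measurableType d) (P : probability Om R) (X : 'I_n -> Om -> R) :
  is_strategy Rb P X ->
  exists e : 'I_n -> R,
    (forall b, \int[P]_om (X b om)%:E = (e b)%:E)%E /\ \sum_(b < n) e b <= Rb.
Proof.
move=> [mX [X0 XR]].
have sumE : (\int[P]_om (\sum_(b < n) X b om)%:E =
             \sum_(b < n) \int[P]_om (X b om)%:E)%E.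
  under eq_integral do rewrite -sumEFin.
  rewrite ge0_integral_sum//= => b; first exact/measurable_EFinP.
  by move=> x _; rewrite lee_fin.
have i0 b : (0 <= \int[P]_om (X b om)%:E)%E.
  by apply: integral_ge0 => x _; rewrite lee_fin.
have fin b : (\int[P]_om (X b om)%:E)%E \is a fin_num.
  rewrite ge0_fin_numE//; apply: (@le_lt_trans _ _ Rb%:E); last exact: ltry.
  apply: le_trans XR; rewrite sumE (bigD1 b)//= leeDl//.
  exact: sume_ge0.
exists (fun b => fine (\int[P]_om (X b om)%:E)%E); split=> [b|].
  by rewrite fineK.
rewrite -lee_fin -sumEFin; apply: le_trans XR; rewrite sumE.
by apply: lee_sum => b _; rewrite fineK.
Qed.

Lemma uniform01E (R : realType) (E : set (measurableTypeR R)) : measurable E ->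
  uniform_prob (@ltr01 R) E = lebesgue_measure (E `&` `[0, 1]%classic).
Proof.
move=> mE; rewrite /uniform_prob integral_uniform_pdf.
under eq_integral => x.
  rewrite inE/= in_itv/= => -[_ xab]; rewrite /uniform_pdf xab subr0 invr1.
over.
rewrite -[RHS]mul1e; apply: integral_cst.
by apply: measurableI => //; exact: measurable_itv.
Qed.

Lemma uniform01_le (R : realType) (E : set (measurableTypeR R)) (y : R) :
  measurable E -> 0 <= y -> (forall u, E u -> u <= y) ->
  (uniform_prob (@ltr01 R) E <= y%:E)%E.
Proof.
move=> mE y0 Ey; rewrite uniform01E//.
apply: (@le_trans _ _ (lebesgue_measure `[0%R, y]%classic)).
  apply: le_measure; rewrite ?inE; first by apply: measurableI => //; exact: measurable_itv.
    exact: measurable_itv.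
  by move=> u [/Ey uy]; rewrite /= !in_itv/= => /andP[-> _].
by rewrite lebesgue_measure_itv/= lte_fin; case: ifP => //; rewrite ?sube0 ?lee_fin.
Qed.

(** For [0 <= a <= 1] it sends the uniform law on [[0, 1]] to an atom of mass [a] at 0 plus unit
    density on []0, 1 - a]]. *)
Definition ramp (R : realType) (a : R) (u : measurableTypeR R) : R := Num.max 0 (u - a).

Lemma measurable_ramp (R : realType) (a : R) : measurable_fun setT (ramp a).
Proof. by apply: measurable_maxr => //; exact: measurable_funB. Qed.

Lemma ramp_ge0 (R : realType) (a : R) u : 0 <= ramp a u.
Proof. by rewrite /ramp le_max lexx. Qed.

Lemma integral_ramp (R : realType) (a : R) : 0 <= a <= 1 ->
  (\int[uniform_prob (@ltr01 R)]_u (ramp a u)%:E = ((1 - a) ^+ 2 / 2)%:E)%E.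
Proof.
move=> /andP[a0 a1].
have /measurable_EFinP mr := @measurable_ramp R a.
rewrite integral_uniform//=; last by move=> u; rewrite lee_fin ramp_ge0.
rewrite subr0 invr1 mul1e.
move: a1; rewrite le_eqVlt => /predU1P[->|a1].
  rewrite subrr expr0n/= mul0r; apply: integral0_eq => u.
  rewrite /= in_itv/= => /andP[_ u1]; congr (_%:E); rewrite /ramp; apply/max_idPl.
  by rewrite subr_le0.
(* The ramp vanishes below [a]; what remains is smooth and integrated by an antiderivative. *)
transitivity (\int[lebesgue_measure]_(x in `[a, 1%R]) (x - a)%:E)%E.
  rewrite [RHS]integral_mkcond [LHS]integral_mkcond; apply: eq_integral => u _.
  rewrite !patchE !mem_setE/= !in_itv/=; case: (leP a u) => au/=.
    by rewrite (le_trans a0 au)/= /ramp; case: ifP => // _; rewrite (max_idPr _)// subr_ge0.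
  by rewrite /ramp (max_idPl _) ?if_same// subr_le0 ltW.
pose F (x : R) := (x - a) ^+ 2 / 2.
have dF (x : R) : is_derive x 1 F (x - a).
  rewrite /F; apply: is_derive_eq.
  by rewrite !scaler0 add0r /GRing.scale/= subr0 mulr1; lra.
have cF (x : R) : F x @[x --> x] --> F x.
  by apply: differentiable_continuous; apply/derivable1_diffP; exact: ex_derive.
rewrite (@continuous_FTC2 _ _ F)//=.
- by rewrite /F subrr expr0n/= mul0r sube0.
- apply: continuous_subspaceT => x; apply: cvgB; [exact: cvg_id|exact: cvg_cst].
- split; first by move=> x _; exact: ex_derive.
  + by apply: cvg_at_right_filter; exact: cF.
  + by apply: cvg_at_left_filter; exact: cF.
- by move=> x _; rewrite derive1E; exact: derive_val.
Qed.

(** * The bids *)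

Lemma measurable_win (R : realType) (dA dB : measure_display)
  (OmA : measurableType dA) (OmB : measurableType dB)
  (XA : OmA -> R) (XB : OmB -> R) (p : R) :
  measurable_fun setT XA -> measurable_fun setT XB ->
  measurable [set z : OmA * OmB | XB z.2 <= XA z.1 + p].
Proof.
move=> mA mB; rewrite -[X in measurable X]setTI.
apply: (@measurable_fun_le _ _ _ setT (fun z : OmA * OmB => XB z.2)
  (fun z : OmA * OmB => XA z.1 + p)) => //.
- exact: (measurableT_comp mB measurable_snd).
- by apply: measurable_funD => //; exact: (measurableT_comp mA measurable_fst).
Qed.

Lemma uniform01_gt (R : realType) (a : R) : 0 <= a <= 1 ->
  (uniform_prob (@ltr01 R) `]a, +oo[%classic = (1 - a)%:E)%E.
Proof.
move=> /andP[a0 a1]; rewrite uniform01E; last exact: measurable_itv.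
rewrite (_ : _ `&` _ = `]a, 1%R]%classic); last first.
  apply/seteqP; split=> u; rewrite /= !in_itv/= ?andbT.
    by move=> [au /andP[_ u1]]; rewrite au.
  by move=> /andP[au u1]; rewrite au u1 (le_trans a0 (ltW au)).
rewrite lebesgue_measure_itv/= lte_fin; case: ltP => [|a1']; first by rewrite EFinB.
by have -> : a = 1; [apply/eqP; rewrite eq_le a1|rewrite subrr].
Qed.

(* With [u] uniform on [0, 1], player A's bid on [b] has an atom at 0 and density
   1 / (w b * be) on ]0, w b * mu b]. *)
Definition bidA (R : realType) (n : nat) (w mu : 'I_n -> R) (be : R)
    (b : 'I_n) (u : measurableTypeR R) : R :=
  w b * be * ramp (1 - mu b / be) u.

(* Player B's bid on [b] has an atom at 0 and density 1 / (w b * al) on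
   ]p b, p b + w b * mu b]. *)
Definition bidB (R : realType) (n : nat) (w p mu : 'I_n -> R) (al : R)
    (b : 'I_n) (u : measurableTypeR R) : R :=
  p b * \1_(`]1 - mu b / al, +oo[%classic) u + w b * al * ramp (1 - mu b / al) u.

Section bids.
Context {R : realType} {n : nat} {w p mu : 'I_n -> R}.
Hypotheses (w_gt0 : forall b, 0 < w b) (p_ge0 : forall b, 0 <= p b).

Lemma cut_itv (mb x : R) : 0 < x -> 0 <= mb <= x -> 0 <= 1 - mb / x <= 1.
Proof.
move=> x0 /andP[m0 mx]; rewrite subr_ge0 ler_pdivrMr// mul1r mx/= gerBl.
by rewrite divr_ge0// ltW.
Qed.

Lemma bidA_ge0 (be : R) b u : 0 < be -> 0 <= bidA w mu be b u.
Proof. by move=> be0; rewrite /bidA !mulr_ge0 ?ramp_ge0// ltW. Qed.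

Lemma bidB_ge0 (al : R) b u : 0 < al -> 0 <= bidB w p mu al b u.
Proof.
by move=> al0; rewrite /bidB addr_ge0// !mulr_ge0 ?ramp_ge0// ltW.
Qed.

Lemma measurable_bidA (be : R) b : measurable_fun setT (bidA w mu be b).
Proof. by apply: measurable_funM => //; exact: measurable_ramp. Qed.

Lemma measurable_bidB (al : R) b : measurable_fun setT (bidB w p mu al b).
Proof.
apply: measurable_funD; apply: measurable_funM => //; exact: measurable_ramp.
Qed.

Lemma integral_bidA (be : R) b : 0 < be -> 0 <= mu b <= be ->
  (\int[uniform_prob (@ltr01 R)]_u (bidA w mu be b u)%:E =
   (w b * (mu b ^+ 2 / (2 * be)))%:E)%E.
Proof.
move=> be0 mb; rewrite /bidA; under eq_integral do rewrite EFinM.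
have /measurable_EFinP mr := @measurable_ramp R (1 - mu b / be).
rewrite ge0_integralZl//=; last 2 first.
- by move=> u _; rewrite lee_fin ramp_ge0.
- by rewrite lee_fin mulr_ge0 ?ltW.
rewrite integral_ramp ?cut_itv// -EFinM; congr (_%:E).
by field; rewrite gt_eqF.
Qed.

Lemma integral_bidB (al : R) b : 0 < al -> 0 <= mu b <= al ->
  (\int[uniform_prob (@ltr01 R)]_u (bidB w p mu al b u)%:E =
   (p b * mu b / al + w b * (mu b ^+ 2 / (2 * al)))%:E)%E.
Proof.
move=> al0 mb; rewrite /bidB; under eq_integral do rewrite EFinD EFinM.
have mE : measurable (`]1 - mu b / al, +oo[%classic : set (measurableTypeR R)).
  exact: measurable_itv.
have /measurable_EFinP mi := @measurable_indic _ (measurableTypeR R) R setT _ mE.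
rewrite ge0_integralD//=.
- rewrite (integral_bidA al0 mb) ge0_integralZl//=; last by rewrite lee_fin.
  rewrite integral_indic//= setIT uniform01_gt ?cut_itv// -EFinM -EFinD.
  by congr (_%:E); ring.
- by move=> u _; rewrite mule_ge0 ?lee_fin.
- exact: emeasurable_funM.
- by move=> u _; rewrite lee_fin; exact: bidA_ge0.
- by apply/measurable_EFinP; exact: measurable_bidA.
Qed.

Lemma bidA_strategy (be RA : R) : 0 < be -> (forall b, 0 <= mu b <= be) ->
  \sum_(b < n) w b * (mu b ^+ 2 / (2 * be)) <= RA ->
  is_strategy RA (uniform_prob (@ltr01 R)) (bidA w mu be).
Proof.
move=> be0 mb h; split; [exact: measurable_bidA|split=> [b u|]].
  exact: bidA_ge0.
under eq_integral do rewrite -sumEFin.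
rewrite ge0_integral_sum//=.
- by under eq_bigr do rewrite integral_bidA//; rewrite sumEFin lee_fin.
- by move=> b; apply/measurable_EFinP; exact: measurable_bidA.
- by move=> b u _; rewrite lee_fin bidA_ge0.
Qed.

Lemma bidB_strategy (al RB : R) : 0 < al -> (forall b, 0 <= mu b <= al) ->
  \sum_(b < n) (p b * mu b / al + w b * (mu b ^+ 2 / (2 * al))) <= RB ->
  is_strategy RB (uniform_prob (@ltr01 R)) (bidB w p mu al).
Proof.
move=> al0 mb h; split; [exact: measurable_bidB|split=> [b u|]].
  exact: bidB_ge0.
under eq_integral do rewrite -sumEFin.
rewrite ge0_integral_sum//=.
- by under eq_bigr do rewrite integral_bidB//; rewrite sumEFin lee_fin.
- by move=> b; apply/measurable_EFinP; exact: measurable_bidB.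
- by move=> b u _; rewrite lee_fin bidB_ge0.
Qed.

(** Against this bid of B, a bid [x] of A on [b] wins with probability at most
    [1 - mu b / al + x / (w b * al)]. This is affine in [x], so only A's means matter, and they sum
    to at most [RA]. *)
Lemma bidB_guarantee (al RA : R) (d : measure_display) (Om : measurableType d)
    (P : probability Om R) (X : 'I_n -> Om -> R) :
  0 < al -> (forall b, 0 <= mu b <= al) -> is_strategy RA P X ->
  payoffA w p P X (uniform_prob (@ltr01 R)) (bidB w p mu al) <=
  \sum_(b < n) w b * (1 - mu b / al) + RA / al.
Proof.
move=> al0 mb sX; have [e [eE eR]] := strategy_mean sX.
have [mX [X0 _]] := sX.
apply: (@le_trans _ _ (\sum_(b < n) w b * (1 - mu b / al) +
    (\sum_(b < n) e b) / al)); last first.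
  by rewrite lerD2l ler_pM2r// invr_gt0.
rewrite mulr_suml -big_split/=; apply: ler_sum => b _.
have wN : w b != 0 by rewrite gt_eqF.
have aN : al != 0 by rewrite gt_eqF.
have wa : 0 < w b * al by rewrite mulr_gt0.
have -> : w b * (1 - mu b / al) + e b / al =
    w b * (1 - mu b / al + (w b * al)^-1 * e b) by field; rewrite aN wN.
rewrite ler_pM2l//.
have /andP[c0 c1] := cut_itv al0 (mb b).
set S := [set z | _].
have mS : measurable S.
  by apply: measurable_win => //; exact: measurable_bidB.
have := @product_prob_le1 R _ _ _ _ P (uniform_prob (@ltr01 R)) S _ (w b * al)^-1
  (X b) mS c0.
have -> : 0 <= (w b * al)^-1 by rewrite invr_ge0 ltW.
move=> /(_ isT (mX b) (X0 b)) h.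
have {}h : ((P \x uniform_prob (@ltr01 R)) S <= (1 - mu b / al + (w b * al)^-1 * e b)%:E)%E.
  rewrite EFinD EFinM -eE; apply: h => x; apply: uniform01_le.
  - exact: measurable_xsection.
  - by rewrite addr_ge0// mulr_ge0// invr_ge0 ltW.
  - move=> u; rewrite /xsection/= inE /S/= /bidB indicE mem_setE in_itv/= andbT.
    have [ua|ua] := leP u (1 - mu b / al).
      by move=> _; apply: le_trans ua _; rewrite lerDl mulr_ge0// invr_ge0 ltW.
    have ur : 0 <= u - (1 - mu b / al) by rewrite subr_ge0 ltW.
    rewrite /ramp (max_idPr ur) mulr1 addrC lerD2r => h2.
    by rewrite -lerBlDl [leRHS]mulrC ler_pdivlMr// [leLHS]mulrC.
by rewrite -lee_fin fineK//; exact: product_prob_fin_num.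
Qed.

(** The mirror argument bounds B's winning probability, the measure of the complement. The minimum
    with 1 keeps the constant of the affine bound nonnegative even where the head start alone
    exceeds [be]. *)
Lemma bidA_guarantee (be RB : R) (d : measure_display) (Om : measurableType d)
    (P : probability Om R) (X : 'I_n -> Om -> R) :
  0 < be -> (forall b, 0 <= mu b <= be) -> is_strategy RB P X ->
  \sum_(b < n) w b * Num.min 1 ((p b / w b + mu b) / be) - RB / be <=
  payoffA w p (uniform_prob (@ltr01 R)) (bidA w mu be) P X.
Proof.
move=> be0 mb sX; have [e [eE eR]] := strategy_mean sX.
have [mX [X0 _]] := sX.
apply: (@le_trans _ _ (\sum_(b < n) w b * Num.min 1 ((p b / w b + mu b) / be) -
    (\sum_(b < n) e b) / be)).
  by rewrite lerD2l lerN2 ler_pM2r// invr_gt0.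
rewrite mulr_suml -sumrB/=; apply: ler_sum => b _.
have wN : w b != 0 by rewrite gt_eqF.
have bN : be != 0 by rewrite gt_eqF.
have wa : 0 < w b * be by rewrite mulr_gt0.
set l := Num.min _ _.
have -> : w b * l - e b / be =
    w b * (1 - (1 - l + (w b * be)^-1 * e b)) by field; rewrite bN wN.
rewrite ler_pM2l//.
have l1 : 0 <= 1 - l by rewrite subr_ge0 /l ge_min lexx.
have l2 : l <= (p b / w b + mu b) / be by rewrite /l ge_min lexx orbT.
set S := [set z | _].
have mS : measurable S.
  by apply: measurable_win => //; exact: measurable_bidA.
have mSC : measurable (~` S) by exact: measurableC.
have := @product_prob_le2 R _ _ _ _ (uniform_prob (@ltr01 R)) P (~` S) _ (w b * be)^-1
  (X b) mSC l1.
have -> : 0 <= (w b * be)^-1 by rewrite invr_ge0 ltW.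
move=> /(_ isT (mX b) (X0 b)) h.
have {}h : ((uniform_prob (@ltr01 R) \x P) (~` S) <= (1 - l + (w b * be)^-1 * e b)%:E)%E.
  rewrite EFinD EFinM -eE; apply: h => x; apply: uniform01_le.
  - exact: measurable_ysection.
  - by rewrite addr_ge0// mulr_ge0// invr_ge0 ltW.
  - move=> u; rewrite /ysection/= inE /S/= /bidA => /negP; rewrite -ltNge => h2.
    have h3 : w b * be * (u - (1 - mu b / be)) + p b < X b x.
      apply: le_lt_trans h2; rewrite lerD2r ler_pM2l// /ramp le_max lexx orbT//.
    have {}h3 : w b * be * u <=
        w b * be * (1 - (p b / w b + mu b) / be + (w b * be)^-1 * X b x).
      have -> : w b * be * (1 - (p b / w b + mu b) / be + (w b * be)^-1 * X b x) =
          w b * be * (1 - mu b / be) - p b + X b x by field; rewrite bN wN.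
      by move: h3; rewrite mulrBr; lra.
    move: h3; rewrite ler_pM2l// => h3; apply: le_trans h3 _.
    by rewrite lerD2r lerD2l lerN2.
move: h; rewrite product_prob_setC//.
have /fineK <- := product_prob_fin_num (uniform_prob (@ltr01 R)) P mS.
by rewrite -EFinB lee_fin /=; lra.
Qed.

End bids.

(** * Stage 2 equilibria *)

Lemma is_strategyW (R : realType) (n : nat) (r r' : R) (d : measure_display)
  (Om : measurableType d) (P : probability Om R) (X : 'I_n -> Om -> R) :
  r <= r' -> is_strategy r P X -> is_strategy r' P X.
Proof.
by move=> rr [mX [X0 h]]; split=> //; split=> //; apply: le_trans h _; rewrite lee_fin.
Qed.

Section equilibrium.
Context {R : realType} {n : nat} {w p : 'I_n -> R} {RA RB al be : R}.
Hypotheses (w_gt0 : forall b, 0 < w b) (p_ge0 : forall b, 0 <= p b).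
Hypotheses (w_sum : \sum_(b < n) w b = 1) (al_gt0 : 0 < al) (be_gt0 : 0 < be).

Let q b := p b / w b.
Let mu b := clip al (be - q b).

Hypothesis budgetA : \sum_(b < n) w b * (mu b ^+ 2 / (2 * be)) = RA.
Hypothesis budgetB :
  \sum_(b < n) w b * (mu b * (2 * q b + mu b) / (2 * al)) = RB.

Let v := \sum_(b < n) w b * (1 - mu b / al) + RA / al.

Let q_ge0 b : 0 <= q b. Proof. by rewrite divr_ge0// ltW. Qed.

Let mu_al b : 0 <= mu b <= al.
Proof. by rewrite clip_ge0/= /mu /clip ge_max ltW//= ge_min lexx. Qed.

Let mu_be b : 0 <= mu b <= be.
Proof.
rewrite clip_ge0/= /mu /clip ge_max ltW//= ge_min; apply/orP; right.
by rewrite gerBl.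
Qed.

Let stratA : is_strategy RA (uniform_prob (@ltr01 R)) (bidA w mu be).
Proof. by apply: bidA_strategy => //; rewrite budgetA. Qed.

Let stratB : is_strategy RB (uniform_prob (@ltr01 R)) (bidB w p mu al).
Proof.
apply: bidB_strategy => //; rewrite -budgetB le_eqVlt; apply/orP; left; apply/eqP.
apply: eq_bigr => b _; have -> : p b = w b * q b.
  by rewrite /q mulrC divfK// gt_eqF.
by field; rewrite gt_eqF.
Qed.

(** B's guarantee [v] equals A's guarantee, by [clip_value] on each battlefield and the two budget
    equations. *)
Let vE : v = \sum_(b < n) w b * Num.min 1 ((q b + mu b) / be) - RB / be.
Proof.
rewrite /v -budgetA -budgetB !mulr_suml -sumrB -big_split/=; apply: eq_bigr => b _.
rewrite clip_value// -/(mu b); ring.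
Qed.

Lemma NE_saddle : stage2_NE_payoff w p RA RB v.
Proof.
have hA d (Om : measurableType d) (P : probability Om R) X : is_strategy RA P X ->
    payoffA w p P X (uniform_prob (@ltr01 R)) (bidB w p mu al) <= v.
  exact: bidB_guarantee.
have hB d (Om : measurableType d) (P : probability Om R) X : is_strategy RB P X ->
    v <= payoffA w p (uniform_prob (@ltr01 R)) (bidA w mu be) P X.
  by move=> sX; rewrite vE; exact: bidA_guarantee.
exists _, _, (uniform_prob (@ltr01 R)), (bidA w mu be).
exists _, _, (uniform_prob (@ltr01 R)), (bidB w p mu al).
by split=> //; apply/eqP; rewrite eq_le hA// hB.
Qed.

(** In any equilibrium B may deviate to the saddle bid, which caps A's payoff at [v] for every
    budget up to [RA]. *)
Lemma NE_le_saddle (RA' v' : R) : RA' <= RA ->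
  stage2_NE_payoff w p RA' RB v' -> v' <= v.
Proof.
move=> RAA [dA [OmA [PA [XA [dB [OmB [PB [XB [sA _ _ _ hB]]]]]]]]].
apply: le_trans (hB _ _ _ _ stratB) _.
exact/bidB_guarantee/(is_strategyW RAA sA).
Qed.

(** Summing [clip_quadratic] with weights [w b]: the terms in [mu b ^+ 2] add up to A's budget, and
    those in [q b] to the total pre-allocation. *)
Lemma saddle_dual : dual_bound RA RB (\sum_(b < n) p b) be^-1 v.
Proof.
move=> la m la0 m0 mla; rewrite vE lerBlDr.
apply: (@le_trans _ _ (\sum_(b < n) w b * (1 + la / (2 * be) *
    (mu b ^+ 2 + m ^+ 2 - 2 * m * (be - q b))))).
  by apply: ler_sum => b _; rewrite ler_pM2l//; exact: clip_quadratic.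
have -> : \sum_(b < n) w b * (1 + la / (2 * be) *
    (mu b ^+ 2 + m ^+ 2 - 2 * m * (be - q b))) =
  \sum_(b < n) (w b * (1 + la / (2 * be) * (m ^+ 2 - 2 * m * be)) +
    la * (w b * (mu b ^+ 2 / (2 * be))) + la * m / be * p b).
  apply: eq_bigr => b _; rewrite /q.
  by field; rewrite !gt_eqF.
rewrite !big_split/= -mulr_suml -!mulr_sumr w_sum budgetA mul1r.
rewrite le_eqVlt; apply/orP; left; apply/eqP.
by field; rewrite !gt_eqF.
Qed.

End equilibrium.

Lemma NE_exists (R : realType) (n : nat) (w p : 'I_n -> R) (RA RB : R) :
  (forall b, 0 < w b) -> \sum_(b < n) w b = 1 -> (forall b, 0 <= p b) ->
  0 < RA -> 0 < RB -> exists v, stage2_NE_payoff w p RA RB v.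
Proof.
move=> w0 w1 p0 RA0 RB0.
have q0 b : 0 <= p b / w b by rewrite divr_ge0// ltW.
have [al [be [al0 be0 eA eB]]] := exists_multipliers w0 w1 q0 RA0 RB0.
by eexists; exact: (NE_saddle w0 p0 al0 be0 eA eB).
Qed.

(** The multipliers are built for a positive budget of A; enlarging [RA'] to [RA] also covers
    [RA' = 0]. *)
Lemma NE_dual (R : realType) (n : nat) (w p : 'I_n -> R) (RA' RA RB v : R) :
  (forall b, 0 < w b) -> \sum_(b < n) w b = 1 -> (forall b, 0 <= p b) ->
  RA' <= RA -> 0 < RA -> 0 < RB -> stage2_NE_payoff w p RA' RB v ->
  exists2 b, 0 < b & dual_bound RA RB (\sum_(b < n) p b) b v.
Proof.
move=> w0 w1 p0 RAA RA0 RB0 NEv.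
have q0 b : 0 <= p b / w b by rewrite divr_ge0// ltW.
have [al [be [al0 be0 eA eB]]] := exists_multipliers w0 w1 q0 RA0 RB0.
exists be^-1; first by rewrite invr_gt0.
move=> la m la0 m0 mla; have h := NE_le_saddle w0 p0 al0 eB RAA NEv; apply: (le_trans h).
exact: (saddle_dual w0 p0 w1 al0 be0 eA eB).
Qed.

(** A pre-allocation proportional to [w] gives every battlefield the same head start [P], so the
    budget equations reduce to a single battlefield of value 1. *)
Lemma NE_proportional (R : realType) (n : nat) (w : 'I_n -> R) (P RA RB al be mu : R) :
  (forall b, 0 < w b) -> \sum_(b < n) w b = 1 -> 0 <= P -> 0 < al -> 0 < be ->
  clip al (be - P) = mu -> mu ^+ 2 / (2 * be) = RA ->
  mu * (2 * P + mu) / (2 * al) = RB ->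
  stage2_NE_payoff w (fun b => w b * P) RA RB (1 - mu / al + RA / al).
Proof.
move=> w0 w1 P0 al0 be0 muE eA eB.
have qE b : w b * P / w b = P by rewrite mulrAC divff ?mul1r// gt_eqF.
have p0 b : 0 <= w b * P by rewrite mulr_ge0// ltW.
have sumE (x : R) : \sum_(b < n) w b * x = x by rewrite -mulr_suml w1 mul1r.
have eA' : \sum_(b < n) w b * (clip al (be - w b * P / w b) ^+ 2 / (2 * be)) = RA.
  by under eq_bigr do rewrite qE muE; rewrite sumE.
have eB' : \sum_(b < n) w b * (clip al (be - w b * P / w b) *
    (2 * (w b * P / w b) + clip al (be - w b * P / w b)) / (2 * al)) = RB.
  by under eq_bigr do rewrite qE muE; rewrite sumE.
have := NE_saddle w0 p0 al0 be0 eA' eB'.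
by under eq_bigr do rewrite qE muE; rewrite sumE.
Qed.

(* Without real-time resources the inequalities for all small budgets [e] give
   [v <= max 0 (1 - RB / M)] in the limit. *)
Lemma dual_limit_lt (R : realFieldType) (c M RB P v : R) :
  0 < c -> c <= 1 -> 0 < M -> 0 < RB -> 0 <= P -> P <= M ->
  (forall e, 0 < e -> exists2 b, 0 < b & dual_bound e RB P b v) ->
  v < opt_formula c M RB.
Proof.
move=> c0 c1 M0 RB0 P0 PM h; rewrite ltNge; apply/negP => vopt.
have key y : 0 < y -> 0 <= v -> exists2 b, 0 < b & v <= 1 - RB * b /\ v <= y + (M - RB) * b.
  (* Since [RB * b <= 1], this budget [e] satisfies [b * e <= y ^+ 2 / 2], so the scaled bound loses
     only [y]. *)
  move=> y0 v0; have [|b b0 db] := h (RB * y ^+ 2 / 2).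
    by rewrite divr_gt0// mulr_gt0// exprn_gt0.
  have v1 := dual_bound0 db.
  exists b => //; split=> //.
  have := dual_bound_scaled b0 db y0.
  have : 0 <= y * b * (M - P) by rewrite !mulr_ge0 ?subr_ge0// ltW.
  have : 0 <= y ^+ 2 * (1 - RB * b) by rewrite mulr_ge0 ?sqr_ge0//; lra.
  rewrite -(ler_pM2r y0); nra.
move: vopt; rewrite /opt_formula; have [RM|RM] := leP RB M => vopt.
  have vM : M - RB * (1 - c / 2) <= M * v.
    rewrite -ler_pdivrMl//; apply: le_trans vopt; rewrite le_eqVlt; apply/orP; left.
    by apply/eqP; field; rewrite gt_eqF.
  have v0 : 0 <= v.
    rewrite -(pmulr_rge0 _ M0); have : 0 < RB * c by rewrite mulr_gt0.
    by lra.
  (* Eliminating [b] from the two bounds leaves an error [RB * c / 4], below the [RB * c / 2] by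
     which the optimum exceeds the limit. *)
  have [|b b0 [h1 h2]] := key (c / 4) _ v0; first by rewrite divr_gt0.
  have : 0 <= (M - RB) * (1 - RB * b - v) by rewrite mulr_ge0 ?subr_ge0.
  have : 0 <= RB * (c / 4 + (M - RB) * b - v) by rewrite mulr_ge0 ?subr_ge0// ltW.
  have : 0 < RB * c by rewrite mulr_gt0.
  nra.
have vp : 0 < v by apply: lt_le_trans vopt; rewrite divr_gt0// mulr_gt0.
have [|b b0 [h1 h2]] := key (v / 2) _ (ltW vp); first by rewrite divr_gt0.
have : 0 < (RB - M) * b by rewrite mulr_gt0// subr_gt0.
nra.
Qed.

(** * The optimal investment *)

(* [c] is [min cA 1] and [M = MA / c]: pre-allocations that cost more than
   real-time resources are never bought, so the price can be capped at 1. *)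
Definition optimal_invest (R : realFieldType) (c M RB P RA : R) : Prop :=
  [/\ 0 <= P, RA + c * P = c * M,
      RB < M -> (1 - c / 2) * P = (1 - c) * M,
      RB = M -> (1 - c / 2) * P <= (1 - c) * M &
      M < RB -> P = 0].

Section optimum.
Context {R : realType} {n : nat} {w : 'I_n -> R} {c M RB : R}.
Hypotheses (w_gt0 : forall b, 0 < w b) (w_sum : \sum_(b < n) w b = 1).
Hypotheses (c_gt0 : 0 < c) (c_le1 : c <= 1) (M_gt0 : 0 < M) (RB_gt0 : 0 < RB).

Lemma NE_le_opt (P RA v : R) (p : 'I_n -> R) :
  in_simplex P p -> 0 <= RA -> RA + c * P <= c * M ->
  stage2_NE_payoff w p RA RB v ->
  v <= opt_formula c M RB /\ (v = opt_formula c M RB -> optimal_invest c M RB P RA).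
Proof.
move=> [p0 pP] RA0 budget NEv.
have P0 : 0 <= P by rewrite -pP sumr_ge0.
(* Spending nothing in real time is strictly suboptimal, so the equality analysis is needed only for
   [RA > 0]. *)
move: RA0; rewrite le_eqVlt => /predU1P[RA0|RA0].
  have PM : P <= M by move: budget; rewrite -RA0 add0r ler_pM2l.
  suff vlt : v < opt_formula c M RB by split; [exact: ltW|move=> vE; rewrite vE ltxx in vlt].
  apply: (dual_limit_lt c_gt0 c_le1 M_gt0 RB_gt0 P0 PM) => e e0.
  by rewrite -pP; apply: NE_dual NEv => //; rewrite -RA0 ltW.
have [|b b0] := NE_dual w_gt0 w_sum p0 _ RA0 RB_gt0 NEv; first exact: lexx.
rewrite pP => db; split.
  exact: (dual_le c_gt0 M_gt0 RB_gt0 P0 budget b0 db).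
move=> vE; case: (ltgtP RB M) => RM.
- have [e1 e2] := dual_eq_lt c_gt0 M_gt0 RB_gt0 (ltW RA0) budget b0 db vE RM.
  by split=> // h; move: RM; rewrite ?h ?ltxx// ltNge ltW.
- have [e1 e2] := dual_eq_gt c_gt0 RB_gt0 P0 budget b0 db vE RA0 RM.
  split=> //; first by rewrite e1 e2 mulr0 addr0.
    by move=> h; move: RM; rewrite ltNge ltW.
  by move=> h; move: RM; rewrite h ltxx.
- have [e1 e2] := dual_eq_eq c_gt0 M_gt0 budget b0 db vE RA0 RM.
  by split=> // h; move: h; rewrite RM ltxx.
Qed.

(** As [1 - c < 1 - c / 2], an optimal [P] stays below [M]. Positivity of [RA] lets [NE_exists]
    apply to every pre-allocation. *)
Lemma optimal_RA_gt0 (P RA : R) : optimal_invest c M RB P RA -> 0 < RA.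
Proof.
move=> [P0 RAE hlt heq hgt].
have hM : 0 < c / 2 * M by rewrite !mulr_gt0 ?invr_gt0.
have c2 : 0 < 1 - c / 2 by have := c_le1; lra.
have PM : P < M.
  rewrite -(ltr_pM2l c2); case: (ltgtP RB M) => RM.
  - by rewrite hlt//; lra.
  - by rewrite hgt// mulr0 mulr_gt0.
  - by apply: le_lt_trans (heq RM) _; lra.
have : 0 < c * (M - P) by rewrite mulr_gt0 ?subr_gt0.
by move: RAE; lra.
Qed.

Lemma optimal_NE (P RA : R) : optimal_invest c M RB P RA ->
  stage2_NE_payoff w (fun b => w b * P) RA RB (opt_formula c M RB).
Proof.
move=> opt; have RA0 := optimal_RA_gt0 opt; case: opt => P0 RAE hlt heq hgt.
have cN : c != 0 by rewrite gt_eqF.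
have MN : M != 0 by rewrite gt_eqF.
have RN : RB != 0 by rewrite gt_eqF.
have c2 : 0 < 1 - c / 2 by have := c_le1; lra.
have c2N : 2 - c != 0 by rewrite gt_eqF//; move: c2; lra.
rewrite /opt_formula; case: (ltgtP RB M) => RM.
- have PE : P = (1 - c) * M / (1 - c / 2).
    by rewrite -(hlt RM) [RHS]mulrC mulKf// gt_eqF.
  (* Here [be] is the inverse of the extremal [b] of [dual_eq_lt], and [al] solves B's budget
     equation. The value [be - P = c * be] is not cut off at [al], because [RB <= M]. *)
  set al := c * M ^+ 2 / ((1 - c / 2) * RB).
  set be := M / (1 - c / 2).
  have al0 : 0 < al by rewrite /al divr_gt0 ?mulr_gt0 ?exprn_gt0.
  have be0 : 0 < be by rewrite divr_gt0.
  have muE : be - P = c * be by rewrite /be PE; field.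
  have mu0 : 0 <= c * be by rewrite mulr_ge0 ?ltW.
  have mual : c * be <= al.
    rewrite /al /be ler_pdivlMr ?mulr_gt0//.
    have -> : c * (M / (1 - c / 2)) * ((1 - c / 2) * RB) = c * M * RB by field.
    by rewrite expr2 mulrA ler_pM2l ?mulr_gt0// ltW.
  have clipE : clip al (be - P) = c * be.
    by rewrite muE /clip (min_idPr mual) (max_idPr mu0).
  have RAE' : RA = c * M - c * P by rewrite -RAE addrK.
  have eA : (c * be) ^+ 2 / (2 * be) = RA by rewrite RAE' PE /be; field; rewrite MN c2N.
  have eB : c * be * (2 * P + c * be) / (2 * al) = RB.
    by rewrite PE /be /al; field; rewrite c2N cN MN RN.
  have := NE_proportional w_gt0 w_sum P0 al0 be0 clipE eA eB.
  congr (stage2_NE_payoff _ _ _ _ _).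
  by rewrite RAE' PE /be /al; field; rewrite c2N cN MN RN.
- have P00 := hgt RM; have RAE' : RA = c * M by rewrite -RAE P00 mulr0 addr0.
  (* With [P = 0] the clip is active, [mu = al]; B's budget then gives [al] and A's gives [be]. *)
  set al := 2 * RB; set be := 2 * RB ^+ 2 / (c * M).
  have al0 : 0 < al by rewrite mulr_gt0.
  have be0 : 0 < be by rewrite divr_gt0 ?mulr_gt0// exprn_gt0.
  have albe : al <= be - P.
    rewrite P00 subr0 ler_pdivlMr ?mulr_gt0// /al expr2 mulrA ler_pM2l ?mulr_gt0//.
    by apply: le_trans (ltW RM); rewrite ler_piMl// ltW.
  have clipE : clip al (be - P) = al.
    by rewrite /clip (min_idPl albe) (max_idPr (ltW al0)).
  have eA : al ^+ 2 / (2 * be) = RA by rewrite RAE' /be /al; field; rewrite cN MN RN.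
  have eB : al * (2 * P + al) / (2 * al) = RB by rewrite P00 /al; field; rewrite RN.
  have := NE_proportional w_gt0 w_sum P0 al0 be0 clipE eA eB.
  congr (stage2_NE_payoff _ _ _ _ _).
  by rewrite RAE' /al; field; rewrite RN.
- have RAE' : RA = c * (M - P) by rewrite mulrBr -RAE addrK.
  have PM : 0 < M - P by move: RA0; rewrite RAE' pmulr_rgt0.
  (* Again [mu = al], and [al <= be - P] is exactly the inequality that [optimal_invest] imposes on
     [P] in this case. *)
  set al := 2 * (M - P); set be := 2 * (M - P) / c.
  have al0 : 0 < al by rewrite mulr_gt0.
  have be0 : 0 < be by rewrite divr_gt0.
  have albe : al <= be - P.
    by rewrite lerBrDr ler_pdivlMr// /al; have := heq RM; lra.
  have clipE : clip al (be - P) = al.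
    by rewrite /clip (min_idPl albe) (max_idPr (ltW al0)).
  have PN : M - P != 0 by rewrite gt_eqF.
  have eA : al ^+ 2 / (2 * be) = RA by rewrite RAE' /be /al; field; rewrite cN PN.
  have eB : al * (2 * P + al) / (2 * al) = RB by rewrite RM /al; field.
  have := NE_proportional w_gt0 w_sum P0 al0 be0 clipE eA eB.
  congr (stage2_NE_payoff _ _ _ _ _).
  by rewrite RAE' RM /al; field; rewrite PN MN.
Qed.

Lemma optimal_SPE (P RA : R) : optimal_invest c M RB P RA ->
  SPE_payoff w P RA RB (opt_formula c M RB).
Proof.
move=> opt; have RA0 := optimal_RA_gt0 opt; split.
- by move=> p [p0 _]; exact: NE_exists.
- exists (fun b => w b * P); last exact: optimal_NE.
  case: opt => P0 _ _ _ _; split=> [b|]; first by rewrite mulr_ge0// ltW.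
  by rewrite -mulr_suml w_sum mul1r.
- move=> p v pP NEv; case: opt => _ RAE _ _ _.
  by have [] := NE_le_opt pP (ltW RA0) _ NEv; rewrite ?RAE.
Qed.

Lemma optimal_exists : exists P RA, optimal_invest c M RB P RA.
Proof.
have c2 : 0 < 1 - c / 2 by have := c_le1; lra.
have [RM|RM] := ltP RB M.
  have PE : (1 - c / 2) * ((1 - c) * M / (1 - c / 2)) = (1 - c) * M.
    by rewrite mulrC divfK// gt_eqF.
  exists ((1 - c) * M / (1 - c / 2)), (c * M - c * ((1 - c) * M / (1 - c / 2))).
  split; rewrite ?PE//; last by move=> h; move: RM; rewrite ltNge ltW.
    by apply: divr_ge0; [rewrite mulr_ge0 ?subr_ge0// ltW|exact: ltW].
  by rewrite subrK.
exists 0, (c * M); split; rewrite ?mulr0 ?addr0//.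
  by rewrite ltNge RM.
by move=> _; rewrite mulr_ge0 ?subr_ge0// ltW.
Qed.

End optimum.

Theorem theorem3 (R : realType) (n : nat) (w : 'I_n -> R)
  (MA cA RB : R) :
  (forall b, 0 < w b) -> \sum_(b < n) w b = 1 ->
  0 < MA -> 0 < cA -> 0 < RB ->
  let t := Num.min 1 (MA / RB) in
  let K := (2 * (1 - cA)) / (2 - cA) * (MA / cA) in
  (forall P RA, opt_invest w MA cA RB P RA <->
     [/\ RA = MA - cA * P,
         cA < t -> P = K,
         cA = t -> 0 <= P <= K &
         t < cA -> P = 0]) /\
  opt_value w MA cA RB
    (if cA < t then 1 - RB / (2 * MA) * (cA * (2 - cA))
     else if 1 <= MA / RB then 1 - RB / (2 * MA)
     else MA / (2 * RB)).
Proof.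
move=> w0 w1 MA0 cA0 RB0 t K.
pose c := Num.min cA 1; pose M := MA / c.
have c0 : 0 < c by rewrite lt_min cA0 ltr01.
have c1 : c <= 1 by rewrite ge_min lexx orbT.
have ccA : c <= cA by rewrite ge_min lexx.
have M0 : 0 < M by rewrite divr_gt0.
have cM : c * M = MA by rewrite mulrC divfK// gt_eqF.
have cN : c != 0 by rewrite gt_eqF.
have RN : RB != 0 by rewrite gt_eqF.
have MN : MA != 0 by rewrite gt_eqF.
have c2 : 0 < 1 - c / 2 by lra.
have c2N : 2 - c != 0 by rewrite gt_eqF//; lra.
(* Lowering the price to [c] only relaxes the budget, so upper bounds proved at [c] hold at [cA]. *)
have capped P RA : feasible_invest MA cA P RA -> RA + c * P <= c * M.
  by move=> [P0 _ h]; rewrite cM; apply: le_trans h; rewrite lerD2l ler_wpM2r.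
(* Below price 1, [M = MA / cA], so comparing [RB] with [M] is comparing [cA] with [MA / RB]. *)
have tcase : cA < 1 -> [/\ RB < M -> cA < t, RB = M -> cA = t & M < RB -> t < cA].
  move=> cA1; have cE : c = cA by rewrite /c (min_idPl (ltW cA1)).
  rewrite /t /M cE; split.
  - by rewrite lt_min cA1/= !ltr_pdivlMr// mulrC.
  - move=> RM; have -> : MA / RB = cA by rewrite RM; field; rewrite -cE cN MN.
    by rewrite (min_idPr (ltW cA1)).
  - by move=> h; rewrite gt_min; apply/orP; right; move: h; rewrite !ltr_pdivrMr// mulrC.
have optE P RA : optimal_invest c M RB P RA <->
    [/\ RA = MA - cA * P, cA < t -> P = K, cA = t -> 0 <= P <= K & t < cA -> P = 0].
  rewrite /optimal_invest cM; have [cA1|cA1] := ltP cA 1.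
    have cE : c = cA by rewrite /c (min_idPl (ltW cA1)).
    have KE : (1 - c / 2) * K = (1 - c) * M.
      by rewrite /K /M cE; field; rewrite -cE c2N cN.
    have K0 : 0 <= K.
      by rewrite -(pmulr_rge0 _ c2) KE mulr_ge0 ?subr_ge0// ltW.
    have PK P' : (1 - c / 2) * P' <= (1 - c) * M -> P' <= K by rewrite -KE ler_pM2l.
    have [tlt teq tgt] := tcase cA1.
    case: (ltgtP RB M) => RM; rewrite -cE.
    - have ct := tlt RM; rewrite -cE in ct; rewrite ct; split=> [[P0 <- h _ _]|[-> h _ _]].
        split=> //; rewrite ?addrK//.
            by move=> _; apply: (mulfI (lt0r_neq0 c2)); rewrite h// KE.
          by move=> e; move: ct; rewrite e ltxx.
        by move=> h2; move: ct; rewrite ltNge ltW.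
      by rewrite (h isT) subrK; split=> // _; rewrite KE.
    - have ct := tgt RM; rewrite -cE in ct; rewrite ct; split=> [[P0 <- _ _ h]|[-> _ _ h]].
        split=> //; rewrite ?addrK//.
          by move=> h2; move: ct; rewrite ltNge ltW.
        by move=> e; move: ct; rewrite e ltxx.
      by rewrite (h isT) subrK; split=> // _; rewrite mulr0 mulr_ge0 ?subr_ge0// ltW.
    - have ct := teq RM; rewrite -cE in ct; rewrite -ct ltxx.
      split=> [[P0 <- _ h _]|[-> _ h _]].
        by split=> //; rewrite ?addrK// => _; rewrite P0 PK// h.
      have /andP[P0 PK'] := h erefl.
      by split=> //; rewrite ?subrK// => _; rewrite -KE ler_pM2l.
  (* At capped price 1 all cases of [optimal_invest] force [P = 0]; the tie [cA = t] occurs only at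
     [cA = 1], where [K = 0]. *)
  have cE : c = 1 by rewrite /c (min_idPr cA1).
  rewrite cE subrr mul0r.
  have h2' : 0 < 1 - 1 / 2 :> R by lra.
  have h2 : 1 - 1 / 2 != 0 :> R by rewrite gt_eqF.
  have t1 : t <= cA by apply: le_trans cA1; rewrite /t ge_min lexx.
  split=> [[P0 RAE hlt heq hgt]|[RAE _ heq hgt]].
    have PE : P = 0.
      case: (ltgtP RB M) => RM; [|exact: hgt|].
        by apply: (mulfI h2); rewrite hlt// mulr0.
      by apply/eqP; rewrite eq_le P0 andbT -(ler_pM2l h2') mulr0 heq.
    have K0 : cA = t -> K = 0.
      move=> e; have cA1' : cA = 1 by apply/eqP; rewrite eq_le cA1 e /t ge_min lexx.
      by rewrite /K cA1' subrr mulr0 !mul0r.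
    split=> //; first by rewrite -RAE PE !mulr0 addr0 subr0.
      by rewrite ltNge t1.
    by move=> e; rewrite PE (K0 e) lexx.
  have PE : P = 0.
    move: t1; rewrite le_eqVlt => /predU1P[e|/hgt//].
    have cA1' : cA = 1 by apply/eqP; rewrite eq_le cA1 -e /t ge_min lexx.
    have := heq (esym e); rewrite /K cA1' subrr mulr0 !mul0r => h.
    by apply/eqP; rewrite eq_le andbC.
  by rewrite RAE PE !mulr0 subr0 addr0; split.
have valE : opt_formula c M RB =
    (if cA < t then 1 - RB / (2 * MA) * (cA * (2 - cA))
     else if 1 <= MA / RB then 1 - RB / (2 * MA) else MA / (2 * RB)).
  rewrite /opt_formula; have [cA1|cA1] := ltP cA 1.
    have cE : c = cA by rewrite /c (min_idPl (ltW cA1)).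
    have [tlt teq tgt] := tcase cA1.
    case: (ltgtP RB M) => RM.
    - by rewrite (tlt RM) /M cE; field; rewrite MN -cE.
    - have ct := tgt RM; rewrite ltNge (ltW ct)/= leNgt cM.
      have -> // : MA / RB < 1.
      move: ct; rewrite /t gt_min => /orP[h|h]; last exact: lt_trans cA1.
      by have := lt_trans h cA1; rewrite ltxx.
    - have ct := teq RM; rewrite -ct ltxx leNgt.
      have -> /= : MA / RB < 1.
        by move: cA1; rewrite ct /t gt_min ltxx.
      by rewrite -cM -RM; field.
  have cE : c = 1 by rewrite /c (min_idPr cA1).
  have ME : M = MA by rewrite /M cE divr1.
  have t1 : t <= cA by apply: le_trans cA1; rewrite /t ge_min lexx.
  rewrite ltNge t1/= cE ME ler_pdivlMr// [1 * RB]mul1r.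
  by case: ifP => _; [field; rewrite MN|rewrite mul1r].
have opt_feasible P RA : optimal_invest c M RB P RA -> feasible_invest MA cA P RA.
  move=> opt; have RA0 := optimal_RA_gt0 c0 c1 M0 opt.
  have [RAE _ _ _] := (optE P RA).1 opt.
  by case: opt => P0 _ _ _ _; split=> //; [exact: ltW|rewrite RAE subrK].
have SPE_le P RA pi : feasible_invest MA cA P RA -> SPE_payoff w P RA RB pi ->
    pi <= opt_formula c M RB /\ (pi = opt_formula c M RB -> optimal_invest c M RB P RA).
  move=> feas [_ [p pP NEp] _]; have budget := capped _ _ feas.
  by case: feas => _ RA0 _; exact: NE_le_opt pP RA0 budget NEp.
have opt_valueP : opt_value w MA cA RB (opt_formula c M RB).
  split; last by move=> P RA pi feas SPE; have [] := SPE_le P RA pi feas SPE.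
  have [P [RA opt]] := @optimal_exists _ _ _ RB c1 M0.
  exists P, RA; split; first exact: opt_feasible.
  exact: optimal_SPE.
rewrite -valE; split=> // P RA; rewrite -optE.
split=> [[feas [pi [SPE [_ hi]]]]|opt].
  have [hle heq] := SPE_le P RA pi feas SPE; apply: heq.
  (* The optimal value is attained at some feasible investment, so the maximality of [pi] gives the
     reverse inequality. *)
  apply/eqP; rewrite eq_le hle/=.
  by case: opt_valueP => -[P2 [RA2 [f2 s2]]] _; exact: hi f2 s2.
split; first exact: opt_feasible.
by exists (opt_formula c M RB); split=> //; exact: optimal_SPE.
Qed.
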